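(* Let $\mathsf C(t)$, $t\ge0$, denote the solution of $\dot{\mathsf C}(t)=-\alpha\,\mathsf C(t)A^T\Gamma^{-1}A\,\mathsf C(t)$ with initial condition $\mathsf C(0)=\mathsf C_0$. Denote the eigenvalues and orthonormal eigenvectors of $\mathsf C(t)$ by $\lambda_i(t)$ and $v_i(t)$, $i=1,\dots,n$, ordered so that $\lambda_1(t)\ge\dots\ge\lambda_n(t)$. Then the following hold. (i) Any set of eigenvalues $\lambda_i(t)$ with corresponding eigenvectors $v_i(t)$, $i=1,\dots,n$, differentiable in time, solves the differential algebraic system $$\dot\lambda_i=-\alpha\lambda_i^2\|Av_i\|_\Gamma^2,$$ $$\dot v_i=\sum_{j\in\{1,\dots,n\}:\ \lambda_j\ne\lambda_i}\frac{\alpha\lambda_i\lambda_j}{\lambda_j-\lambda_i}\langle Av_i,Av_j\rangle_\Gamma\,v_j,$$ $$0=\lambda_i^2\langle Av_i,Av_j\rangle_\Gamma\qquad\text{if } i\ne j\text{ but }\lambda_i=\lambda_j .$$ (ii) The eigenvalues satisfy, for all $t\ge0$, $$\lambda_i(t)\ge\frac{\lambda_i(0)}{\alpha\|\Gamma^{-1/2}A\|^2\,t\,\lambda_i(0)+1}\quad\text{for all } i=1,\dots,n,$$ $$\lambda_1(t)\ge\frac{\lambda_1(0)}{\alpha\|Av_1(0)\|_\Gamma^2\,t\,\lambda_1(0)+1},\qquad \lambda_n(t)\le\frac{\lambda_n(0)}{\alpha\|Av_n(0)\|_\Gamma^2\,t\,\lambda_n(0)+1}.$$ (iii) For every $i=1,\dots,n$: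 $\lim_{t\to\infty}\lambda_i(t)=0$ or $\lim_{t\to\infty}Av_i(t)=0$.
   Context: $A\in\mathbb R^{m\times n}$; $\Gamma\in\mathbb R^{m\times m}$ is symmetric positive definite; $\mathsf C_0\in\mathbb R^{n\times n}$ is symmetric positive definite; $\alpha>0$. $\langle x,z\rangle_\Gamma:=\langle x,\Gamma^{-1}z\rangle$, $\|x\|_\Gamma^2:=\langle x,\Gamma^{-1}x\rangle$; $\|\Gamma^{-1/2}A\|$ is the spectral (operator) norm. Convention for (i): times $t^\star$ with $\lambda_i(t^\star)=\lambda_j(t^\star)$ but $\lambda_i(t)\ne\lambda_j(t)$ for $t\ne t^\star$ near $t^\star$ are disregarded, i.e. the system is considered only on open time intervals on which, for each pair $i,j$, the eigenvalues $\lambda_i,\lambda_j$ are either everywhere distinct or identically equal. If $\lambda_i(t)=\lambda_j(t)$ with $i\ne j$ for all $t$ in such an interval, the intrinsic ambiguity in the choice of eigenvectors is removed by requiring $\langle\dot v_i,v_j\rangle=0$. *)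

(* Defs.v *)
From HB Require Import structures.
From mathcomp Require Import all_boot all_order all_algebra sesquilinear.
From mathcomp Require Import all_classical all_reals all_analysis.

Set Implicit Arguments.
Unset Strict Implicit.
Unset Printing Implicit Defensive.

Import Order.TTheory GRing.Theory Num.Theory.
Import numFieldNormedType.Exports.

Local Open Scope ring_scope.
Local Open Scope classical_set_scope.

(* The norm that the library puts on ['cV[R]_n] is the sup norm; [dotv] and
   [enorm] are the Euclidean ones.  Limits and derivatives of matrix-valued
   functions do not depend on this choice. *)
Definition dotv (R : realType) (n : nat) (x y : 'cV[R]_n) : R :=
  (x^T *m y) 0 0.

Definition enorm (R : realType) (n : nat) (x : 'cV[R]_n) : R :=
  Num.sqrt (dotv x x).

Definition opnorm (R : realType) (m n : nat) (M : 'M[R]_(m, n)) : R :=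
  sup [set enorm (M *m x) | x in [set x : 'cV[R]_n | enorm x <= 1]].

Definition sym_posdef (R : realType) (n : nat) (M : 'M[R]_n) : Prop :=
  M \is symmetricmx /\ forall x : 'cV[R]_n, x != 0 -> 0 < dotv x (M *m x).

(* The symmetric positive definite square root; the default value [0] is only
   taken when there is none. *)
Definition sqrtmx (R : realType) (n : nat) (M : 'M[R]_n) : 'M[R]_n :=
  xget 0 [set S | sym_posdef S /\ S *m S = M].

Definition gdot (R : realType) (m : nat) (Gamma : 'M[R]_m) (x z : 'cV[R]_m) : R :=
  dotv x (invmx Gamma *m z).

Definition gnorm2 (R : realType) (m : nat) (Gamma : 'M[R]_m) (x : 'cV[R]_m) : R :=
  gdot Gamma x x.

(* Only [t >= 0] matters: at [t = 0] the solution is required to be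
   right-continuous, hence (by the equation) right-differentiable. *)
Definition riccati_solution (R : realType) (m n : nat) (A : 'M[R]_(m, n))
    (Gamma : 'M[R]_m) (alpha : R) (C0 : 'M[R]_n) (C : R -> 'M[R]_n) : Prop :=
  [/\ C 0 = C0,
      C t @[t --> 0^'+] --> C0
    & forall t : R, 0 < t ->
        is_derive t 1 C
          (- alpha *: (C t *m A^T *m invmx Gamma *m A *m C t))].

(* As the [n] vectors [v i] are orthonormal, [lam] lists all eigenvalues of
   [M] with their multiplicities. *)
Definition eigen_system (R : realType) (n : nat) (M : 'M[R]_n)
    (lam : 'I_n -> R) (v : 'I_n -> 'cV[R]_n) : Prop :=
  (forall i, M *m v i = lam i *: v i) /\
  (forall i j, dotv (v i) (v j) = (i == j)%:R).

(* Main.v *)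
(* Writing [B] for [A^T Gamma^-1 A], the solution satisfies
   [C t ^-1 = C0^-1 + alpha t B]: a Gronwall argument shows that the product of
   [C t] with the right-hand side stays equal to 1.  Hence the numbers
   [1 / lam i t] are the eigenvalues of an affine function of [t] with positive
   semidefinite slope, and (ii) follows from the Courant-Fischer principle:
   Weyl's inequality gives the first bound, and testing the Rayleigh quotient at
   the extreme eigenvectors of [C0] gives the other two.  For (iii),
   [lam i] is nonincreasing, and [alpha t |A v_i|^2 <= 1 / lam i t], so [A v_i]
   tends to 0 if [lam i] is bounded away from 0.  Part (i) is obtained by
   differentiating [<v_i, v_j> = delta_ij] and
   [<v_i, C v_j> = lam_j delta_ij]. *)
Require Import Defs.
From HB Require Import structures.
From mathcomp Require Import all_boot all_order all_algebra sesquilinear.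
From mathcomp Require Import spectral complex ring lra.
From mathcomp Require Import all_classical all_reals all_analysis.

Set Implicit Arguments.
Unset Strict Implicit.
Unset Printing Implicit Defensive.

Import Order.TTheory GRing.Theory Num.Theory.
Import numFieldNormedType.Exports.

Local Open Scope ring_scope.
Local Open Scope classical_set_scope.

(** * Positive definite matrices and their square roots *)

Lemma symmetricmxP (R : realType) n (M : 'M[R]_n) :
  reflect (M^T = M) (M \is symmetricmx).
Proof.
apply: (iffP (is_hermitianmxP _ _ _)); rewrite expr0 scale1r map_mx_id//.
Qed.

(** Newton interpolation: the polynomial for [s] is corrected by a multiple of the product of the
    ['X - b] over [b] in [s], which vanishes on [s] but not at the new point. *)
Lemma poly_interpolation (F : fieldType) (f : F -> F) (s : seq F) :
  exists p : {poly F}, forall x, x \in s -> p.[x] = f x.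
Proof.
elim: s => [|a s [p Hp]]; first by exists 0.
have [as_|as_] := boolP (a \in s).
  by exists p => x; rewrite inE => /predU1P[->|]; exact: Hp.
pose q : {poly F} := \prod_(b <- s) ('X - b%:P).
have qa : q.[a] != 0 by rewrite -rootE root_prod_XsubC.
exists (p + ((f a - p.[a]) / q.[a]) *: q) => x; rewrite inE hornerD hornerZ.
have [-> _|_ /= xs] := eqVneq x a; first by rewrite divfK// addrC subrK.
have /eqP -> : root q x by rewrite root_prod_XsubC.
by rewrite mulr0 addr0 Hp.
Qed.

Lemma horner_mx_tr (R : comNzRingType) n (M : 'M[R]_n.+1) (p : {poly R}) :
  (horner_mx M p)^T = horner_mx M^T p.
Proof.
elim/poly_ind: p => [|p c IH]; first by rewrite !rmorph0 trmx0.
rewrite !rmorphD/= !rmorphM/= !horner_mx_C !horner_mx_X raddfD/= tr_scalar_mx.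
rewrite -!mulmxE trmx_mul IH; congr (_ + _).
by apply/comm_mx_horner.
Qed.

Lemma dotvC (R : realType) n (x y : 'cV[R]_n) : dotv x y = dotv y x.
Proof. by rewrite /dotv -[x^T *m y]trmxK trmx_mul trmxK mxE. Qed.

Lemma dotvE (R : realType) n (x y : 'cV[R]_n) :
  dotv x y = \sum_i x i 0 * y i 0.
Proof. by rewrite /dotv mxE; apply: eq_bigr => i _; rewrite mxE. Qed.

Lemma dotv_ge0 (R : realType) n (x : 'cV[R]_n) : 0 <= dotv x x.
Proof. by rewrite dotvE sumr_ge0// => i _; rewrite -expr2 sqr_ge0. Qed.

Lemma dotv_eq0 (R : realType) n (x : 'cV[R]_n) : (dotv x x == 0) = (x == 0).
Proof.
apply/idP/eqP => [|->]; last by rewrite /dotv mulmx0 mxE.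
rewrite dotvE psumr_eq0 => [/allP x0|i _]; last by rewrite -expr2 sqr_ge0.
apply/colP => i; have := x0 i; rewrite mem_index_enum mxE => /(_ isT).
by rewrite mulf_eq0 orbb => /eqP.
Qed.

Lemma dotv_gt0 (R : realType) n (x : 'cV[R]_n) : x != 0 -> 0 < dotv x x.
Proof. by rewrite lt0r dotv_ge0 dotv_eq0 andbT. Qed.

Lemma dotv_mull (R : realType) m n (M : 'M[R]_(m, n)) x y :
  dotv (M *m x) y = dotv x (M^T *m y).
Proof. by rewrite /dotv trmx_mul mulmxA. Qed.

(** The quadratic form would vanish at a nonzero kernel vector. *)
Lemma posdef_unit (R : realType) n (M : 'M[R]_n) : sym_posdef M -> M \in unitmx.
Proof.
case=> sM pM; rewrite -unitmx_tr -row_free_unit; apply/row_freeP.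
suff : kermx M^T == 0 by rewrite kermx_eq0 => /row_freeP.
apply/eqP/row_matrixP => i; rewrite row0.
have : row i (kermx M^T) *m M^T = 0 by rewrite -row_mul mulmx_ker row0.
move: (row i _) => u uM.
have [//|u0] := eqVneq u 0.
have : u^T != 0 by rewrite -(trmx0 R) (inj_eq trmx_inj).
move=> /pM; rewrite /dotv -[M]trmxK -trmx_mul uM trmx0 mulmx0 mxE.
by rewrite ltxx.
Qed.

Lemma posdef_eigenvalue_gt0 (R : realType) n (M : 'M[R]_n) r :
  sym_posdef M -> eigenvalue M r -> 0 < r.
Proof.
move=> [/symmetricmxP sM pM] /eigenvalueP[u uM u0].
have u0' : u^T != 0 by rewrite -(trmx0 R) (inj_eq trmx_inj).
have := pM _ u0'; rewrite -{1}sM -trmx_mul uM /dotv linearZ/= -scalemxAr.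
by rewrite mxE pmulr_lgt0// dotv_gt0.
Qed.

(* The complexification of a real symmetric matrix is hermitian, so it is
   unitarily diagonalizable with real eigenvalues. *)
Lemma symmetric_horner_spectral (R : realType) n (M : 'M[R]_n.+1) :
  M^T = M -> exists d : 'I_n.+1 -> R, (forall i, eigenvalue M (d i)) /\
   forall p : {poly R}, (forall i, p.[d i] = 0) -> horner_mx M p = 0.
Proof.
move=> sM; pose f := real_complex R; pose MC := map_mx f M.
have MCherm : MC \is hermsymmx.
  apply: realsym_hermsym.
    by apply/is_hermitianmxP; rewrite expr0 scale1r map_mx_id// map_trmx sM.
  by apply/mxOverP => i j; rewrite mxE; apply/complex_realP; exists (M i j).
have /orthomx_spectralP MCE := hermitian_normalmx MCherm.
have /mxOverP dreal := hermitian_spectral_diag_real MCherm.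
have Pu := spectral_unit MC.
set P := spectralmx MC in MCE Pu; set D := spectral_diag MC in MCE dreal.
have dE i : exists r : R, D 0 i = f r by apply/complex_realP; exact: dreal.
have [d dP] := choice dE.
have DE : D = map_mx f (\row_i d i) by apply/rowP => i; rewrite !mxE.
exists d; split=> [i|p p0].
  suff : eigenvalue MC (D 0 i).
    by rewrite !eigenvalue_root_char dP -map_char_poly fmorph_root.
  (* By the spectral decomposition [P *m MC = diag_mx D *m P], so the rows of [P] are left
     eigenvectors; they are nonzero because [P] is invertible. *)
  apply/eigenvalueP; exists (row i P); last first.
    apply/eqP => /(congr1 (mulmx^~ (invmx P))).
    rewrite -row_mul mulmxV// mul0mx => /rowP/(_ i)/eqP.
    by rewrite !mxE eqxx oner_eq0.
  rewrite -row_mul {1}MCE !mulmxA mulmxV// mul1mx row_mul.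
  by rewrite row_diag_mx -scalemxAl -rowE.
apply: (map_mx_inj (f := f)); rewrite map_mx0 map_horner_mx -/MC MCE.
rewrite (horner_mx_uconjC _ _ Pu) horner_mx_diag.
rewrite (_ : map_mx (horner (map_poly f p)) D = 0) ?raddf0 ?mulmx0 ?mul0mx//.
by apply/rowP => i; rewrite !mxE dP horner_map p0 rmorph0.
Qed.

(* The root is [p M], where [p] interpolates the fourth root on the spectrum
   of [M].  Being a square, [S ^+ 2] is then a positive definite square root. *)
Lemma posdef_root (R : realType) n (M : 'M[R]_n.+1) : sym_posdef M ->
  exists S : 'M[R]_n.+1, S^T = S /\ S ^+ 4 = M.
Proof.
move=> pM; have [/symmetricmxP sM _] := pM.
have [d [dM d0]] := symmetric_horner_spectral sM.
have [p pd] := poly_interpolation (fun x => Num.sqrt (Num.sqrt x)) (codom d).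
exists (horner_mx M p); split; first by rewrite horner_mx_tr sM.
(* The difference is the value at [M] of [p ^+ 4 - 'X], which vanishes at each [d i] because
   [d i > 0]. *)
apply/eqP; rewrite -subr_eq0 -{2}[M]horner_mx_X -rmorphXn -rmorphB /=.
apply/eqP/d0 => i; rewrite hornerD hornerN horner_exp hornerX.
rewrite pd ?codom_f// -[4%N]/(2 * 2)%N exprM !sqr_sqrtr ?sqrtr_ge0 ?subrr//.
exact/ltW/(posdef_eigenvalue_gt0 pM).
Qed.

(** For a symmetric fourth root [T], <x, T^2 x> = |T x|^2, and [T x] is nonzero because T^4 = M is
    invertible. Dimension 0 is separate, since [posdef_root] is about size [n.+1]. *)
Lemma sqrtmx_posdef (R : realType) n (M : 'M[R]_n) : sym_posdef M ->
  sym_posdef (sqrtmx M) /\ sqrtmx M *m sqrtmx M = M.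
Proof.
move=> pM; rewrite /sqrtmx.
suff [S HS] : exists S, sym_posdef S /\ S *m S = M.
  by have := xgetI (P := [set S | sym_posdef S /\ S *m S = M]) 0 HS.
case: n M pM => [|n] M pM.
  by exists M; split=> //; apply/matrixP => -[].
have [T [sT TM]] := posdef_root pM; exists (T *m T).
split; last by rewrite !mulmxE -TM !exprS expr0 mulr1 !mulrA.
split; first by apply/symmetricmxP; rewrite trmx_mul sT.
move=> x x0; rewrite -mulmxA -{1}sT -dotv_mull dotv_gt0//.
apply: contraNneq x0 => Tx.
rewrite -(mulKmx (posdef_unit pM) x) -TM !exprS expr0 mulr1 -!mulmxE -!mulmxA.
by rewrite Tx !mulmx0.
Qed.

(** * Euclidean, operator and weighted norms *)

Lemma dotvDr (R : realType) n (x y z : 'cV[R]_n) :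
  dotv x (y + z) = dotv x y + dotv x z.
Proof. by rewrite /dotv mulmxDr mxE. Qed.

Lemma dotvZr (R : realType) n a (x y : 'cV[R]_n) :
  dotv x (a *: y) = a * dotv x y.
Proof. by rewrite /dotv -scalemxAr mxE. Qed.

Lemma dotv_sumr (R : realType) n I r (P : pred I) (x : 'cV[R]_n)
    (F : I -> 'cV[R]_n) :
  dotv x (\sum_(i <- r | P i) F i) = \sum_(i <- r | P i) dotv x (F i).
Proof. by rewrite /dotv mulmx_sumr summxE. Qed.

Lemma dotvZl (R : realType) n a (x y : 'cV[R]_n) :
  dotv (a *: x) y = a * dotv x y.
Proof. by rewrite dotvC dotvZr dotvC. Qed.

Lemma enorm_sqr (R : realType) n (x : 'cV[R]_n) : enorm x ^+ 2 = dotv x x.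
Proof. by rewrite sqr_sqrtr// dotv_ge0. Qed.

Lemma sqr_coord_le (R : realType) n (x : 'cV[R]_n) i : x i 0 ^+ 2 <= dotv x x.
Proof.
rewrite dotvE (bigD1 i)//= -expr2 lerDl sumr_ge0// => j _.
by rewrite -expr2 sqr_ge0.
Qed.

Lemma opnorm_has_sup (R : realType) m n (M : 'M[R]_(m, n)) :
  has_sup [set enorm (M *m x) | x in [set x : 'cV[R]_n | enorm x <= 1]].
Proof.
split.
  exists (enorm (M *m 0)), 0 => //=.
  by rewrite /enorm /dotv mulmx0 mxE sqrtr0.
(* On the unit ball all coordinates are at most 1 in absolute value, so coordinate [i] of [M *m x]
   is bounded by the absolute sum of row [i]. *)
exists (Num.sqrt (\sum_i (\sum_j `|M i j|) ^+ 2)) => _ [x /= x1 <-].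
rewrite /enorm ler_sqrt ?sumr_ge0// => [|i _]; last exact: sqr_ge0.
rewrite dotvE ler_sum// => i _; rewrite -expr2 -real_normK ?num_real//.
rewrite ler_sqr ?nnegrE ?sumr_ge0// mxE (le_trans (ler_norm_sum _ _ _))//.
apply: ler_sum => j _; rewrite normrM ler_piMr//.
rewrite -(@ler_sqr _ `|x j 0| 1) ?nnegrE// real_normK ?num_real// expr1n.
rewrite (le_trans (sqr_coord_le x j))// -enorm_sqr.
by rewrite -(expr1n R 2) ler_sqr ?nnegrE// sqrtr_ge0.
Qed.

Lemma dotv_opnorm (R : realType) m n (M : 'M[R]_(m, n)) (x : 'cV[R]_n) :
  dotv (M *m x) (M *m x) <= opnorm M ^+ 2 * dotv x x.
Proof.
have [->|x0] := eqVneq x 0; first by rewrite /dotv !mulmx0 mxE mulr0.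
have ex : 0 < enorm x by rewrite sqrtr_gt0 dotv_gt0.
pose y := (enorm x)^-1 *: x.
have y1 : enorm y <= 1.
  rewrite /enorm dotvZl dotvZr -enorm_sqr expr2 mulKf ?gt_eqF//.
  by rewrite mulVf ?gt_eqF// sqrtr1.
have My : enorm (M *m y) <= opnorm M.
  by apply: sup_upper_bound; [exact: opnorm_has_sup|exists y].
have xE : x = enorm x *: y by rewrite scalerA divff ?scale1r// gt_eqF.
rewrite -(enorm_sqr x) {1 2}xE; clearbody y.
rewrite -scalemxAr dotvZl dotvZr mulrA -expr2 -enorm_sqr mulrC.
rewrite ler_wpM2r ?sqr_ge0// ler_sqr ?nnegrE ?sqrtr_ge0//.
by rewrite (le_trans _ My)// sqrtr_ge0.
Qed.

(** With S the square root, S^-1 is symmetric and Gamma^-1 = S^-1 S^-1. This links the weighted norm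
    to the operator norm of Gamma^-1/2 A in (ii). *)
Lemma gnorm2_sqrtmx (R : realType) m (G : 'M[R]_m) (y : 'cV[R]_m) :
  sym_posdef G ->
  gnorm2 G y = dotv (invmx (sqrtmx G) *m y) (invmx (sqrtmx G) *m y).
Proof.
move=> pG; have [pS SG] := sqrtmx_posdef pG; have [/symmetricmxP sS _] := pS.
have uS := posdef_unit pS; have uG := posdef_unit pG.
move: (sqrtmx G) SG sS uS {pS} => S SG sS uS.
rewrite dotv_mull trmx_inv sS mulmxA /gnorm2 /gdot; congr (dotv _ (_ *m _)).
apply: (can_inj (mulKmx uG)); rewrite mulmxV// -[in RHS]SG.
by rewrite !mulmxA mulmxK// mulmxV.
Qed.

Lemma gnorm2_ge0 (R : realType) m (G : 'M[R]_m) (y : 'cV[R]_m) :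
  sym_posdef G -> 0 <= gnorm2 G y.
Proof. by move=> pG; rewrite gnorm2_sqrtmx// dotv_ge0. Qed.

(** With y = M^-1 x, the form <x, M^-1 x> equals <y, M y>. *)
Lemma posdef_inv (R : realType) n (M : 'M[R]_n) :
  sym_posdef M -> sym_posdef (invmx M).
Proof.
move=> pM; have [/symmetricmxP sM pM'] := pM; have uM := posdef_unit pM.
split; first by apply/symmetricmxP; rewrite trmx_inv sM.
move=> x x0; rewrite -{1}(mulKVmx uM x) dotvC pM'//.
by apply: contraNneq x0 => Mx; rewrite -(mulKVmx uM x) Mx mulmx0.
Qed.

(** * Eigenvector expansions and Weyl's inequality *)

Section EigenSystem.
Variables (R : realType) (n : nat) (M : 'M[R]_n).
Variables (lam : 'I_n -> R) (v : 'I_n -> 'cV[R]_n).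
Hypothesis Mlv : eigen_system M lam v.

Lemma eigen_expansion x : x = \sum_j dotv (v j) x *: v j.
Proof.
case: Mlv => _ vv; pose V := \matrix_(i, j) v j i 0.
have VV : V^T *m V = 1%:M.
  apply/matrixP => i j; rewrite !mxE -vv dotvE.
  by apply: eq_bigr => k _; rewrite !mxE.
rewrite -[LHS]mul1mx -(mulmx1C VV) -mulmxA; apply/colP => i.
rewrite mxE summxE; apply: eq_bigr => j _.
rewrite !mxE mulrC dotvE; congr (_ * _).
by apply: eq_bigr => k _; rewrite !mxE.
Qed.

Lemma eigen_dot x y : dotv x y = \sum_j dotv (v j) x * dotv (v j) y.
Proof.
rewrite [in LHS](eigen_expansion y) dotv_sumr; apply: eq_bigr => j _.
by rewrite dotvZr mulrC dotvC.
Qed.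

Lemma eigen_form x y :
  dotv x (M *m y) = \sum_j lam j * (dotv (v j) x * dotv (v j) y).
Proof.
case: Mlv => Mv _; rewrite [in LHS](eigen_expansion y) mulmx_sumr dotv_sumr.
apply: eq_bigr => j _; rewrite -scalemxAr Mv !dotvZr (dotvC x); ring.
Qed.

(** The hypothesis concerns only eigenvectors not orthogonal to [x], which is what a Courant-Fischer
    vector provides. *)
Lemma eigen_form_le c (x : 'cV[R]_n) :
  (forall j, dotv (v j) x != 0 -> lam j <= c) ->
  dotv x (M *m x) <= c * dotv x x.
Proof.
move=> lc; rewrite eigen_form eigen_dot mulr_sumr ler_sum// => j _.
have [->|/lc ljc] := eqVneq (dotv (v j) x) 0; first by rewrite !mulr0.
by rewrite ler_wpM2r// -expr2 sqr_ge0.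
Qed.

Lemma eigen_form_ge c (x : 'cV[R]_n) :
  (forall j, dotv (v j) x != 0 -> c <= lam j) ->
  c * dotv x x <= dotv x (M *m x).
Proof.
move=> lc; rewrite eigen_form eigen_dot mulr_sumr ler_sum// => j _.
have [->|/lc ljc] := eqVneq (dotv (v j) x) 0; first by rewrite !mulr0.
by rewrite ler_wpM2r// -expr2 sqr_ge0.
Qed.

Lemma eigen_sym x y : dotv x (M *m y) = dotv (M *m x) y.
Proof.
rewrite eigen_form dotvC eigen_form; apply: eq_bigr => j _.
by rewrite [dotv _ x * _]mulrC.
Qed.

Lemma eigen_neq0 i : v i != 0.
Proof.
case: Mlv => _ /(_ i i); rewrite eqxx; apply: contra_eqN => /eqP ->.
by rewrite /dotv mulmx0 mxE eq_sym oner_eq0.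
Qed.

Lemma eigen_system_inv : M \in unitmx ->
  eigen_system (invmx M) (fun i => (lam i)^-1) v.
Proof.
move=> uM; case: (Mlv) => Mv vv; split=> // i.
have li : lam i != 0.
  apply: contraNneq (eigen_neq0 i) => li.
  by rewrite -(mulKmx uM (v i)) Mv li scale0r mulmx0.
by rewrite -{2}(mulKmx uM (v i)) Mv -scalemxAr scalerA mulVf// scale1r.
Qed.

End EigenSystem.

(* [x] is orthogonal to [v j] for [j > i] and to [w j] for [j < i]: these are
   only [n] linear conditions. *)
Lemma courant_fischer_vector (R : realType) n (v w : 'I_n -> 'cV[R]_n)
    (i : 'I_n) :
  exists2 x : 'cV[R]_n, x != 0 & forall j : 'I_n,
    ((i < j)%N -> dotv (v j) x = 0) /\ ((j < i)%N -> dotv (w j) x = 0).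
Proof.
pose N := \matrix_(k < n, j < n) (if (i < j)%N then v j k 0
                          else if (j < i)%N then w j k 0 else 0).
(* Column [i] of [N] is zero, so [N] is singular and has a nonzero left kernel vector. *)
have [u u0 uN] : exists2 u : 'rV_n, u != 0 & u *m N = 0.
  apply/det0P; rewrite -det_tr; apply/det0P; exists (delta_mx 0 i).
    apply/eqP => /rowP/(_ i)/eqP; rewrite !mxE !eqxx.
    by rewrite oner_eq0.
  by rewrite -rowE; apply/rowP => k; rewrite !mxE ltnn.
exists u^T => [|j]; first by rewrite -(trmx0 R) (inj_eq trmx_inj).
have /rowP/(_ j) := uN; rewrite !mxE => uNj.
split=> ij; rewrite -[RHS]uNj dotvE; apply: eq_bigr => k _;
  rewrite !mxE ?ij 1?mulrC//.
by rewrite ltnNge (ltnW ij) mulrC.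
Qed.

(** At the Courant-Fischer vector x, b_i |x|^2 <= <x, Q x> <= <x, P x> + c |x|^2 <= (a_i + c) |x|^2;
    both lists are in increasing order. *)
Lemma weyl_le (R : realType) n (P Q : 'M[R]_n) (a b : 'I_n -> R) v w c :
  eigen_system P a v -> eigen_system Q b w ->
  (forall i j : 'I_n, (i <= j)%N -> a i <= a j) ->
  (forall i j : 'I_n, (i <= j)%N -> b i <= b j) ->
  (forall x, dotv x (Q *m x) <= dotv x (P *m x) + c * dotv x x) ->
  forall i, b i <= a i + c.
Proof.
move=> eP eQ ma mb PQ i.
have [x x0 xvw] := courant_fischer_vector v w i.
rewrite -(ler_pM2r (dotv_gt0 x0)) mulrDl.
apply: le_trans (le_trans (PQ x) _).
  apply: (eigen_form_ge eQ) => j jx; apply: mb; rewrite leqNgt.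
  by apply: contraNN jx => /(xvw j).2 ->.
rewrite lerD2r; apply: (eigen_form_le eP) => j jx; apply: ma; rewrite leqNgt.
by apply: contraNN jx => /(xvw j).1 ->.
Qed.

(** * Derivatives and limits of matrix-valued functions *)

Lemma is_derive_mxP (R : realType) m n (F : R -> 'M[R]_(m, n)) (t : R)
    (dF : 'M[R]_(m, n)) :
  is_derive t 1 F dF <-> forall i j, is_derive t 1 (fun s => F s i j) (dF i j).
Proof.
split=> [[Ft <-] i j|FE].
  split; first exact: (derivable_mxP _ _ _).1.
  by rewrite derive_mx// mxE.
have Ft : derivable F t 1.
  by apply/derivable_mxP => i j; have [] := FE i j.
split=> //; rewrite derive_mx//; apply/matrixP => i j.
by rewrite mxE; have [_ <-] := FE i j.
Qed.

Lemma is_derive_mulmx (R : realType) m n p (F : R -> 'M[R]_(m, n))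
    (G : R -> 'M[R]_(n, p)) (t : R) dF dG :
  is_derive t 1 F dF -> is_derive t 1 G dG ->
  is_derive t 1 (fun s => F s *m G s) (dF *m G t + F t *m dG).
Proof.
move=> /is_derive_mxP Ft /is_derive_mxP Gt; apply/is_derive_mxP => i j.
rewrite (_ : (fun s => _) =
    \sum_k ((fun s => F s i k) * (fun s => G s k j))); last first.
  by apply/funext => s; rewrite mxE fct_sumE.
have FGt k : is_derive t 1 ((fun s => F s i k) * (fun s => G s k j))
    (F t i k *: dG k j + G t k j *: dF i k) by exact: is_deriveM.
apply: is_derive_eq (is_derive_sum FGt) _.
rewrite !mxE -big_split/=; apply: eq_bigr => k _.
by rewrite addrC; congr (_ + _); rewrite [LHS]mulrC.
Qed.

Lemma is_derive_trmx (R : realType) m n (F : R -> 'M[R]_(m, n)) (t : R) dF :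
  is_derive t 1 F dF -> is_derive t 1 (fun s => (F s)^T) dF^T.
Proof.
move=> /is_derive_mxP Ft; apply/is_derive_mxP => i j; rewrite mxE.
rewrite (_ : (fun s => _) = fun s => F s j i)//.
by apply/funext => s; rewrite mxE.
Qed.

Lemma is_derive_dotv (R : realType) n (x y : R -> 'cV[R]_n) (t : R) dx dy :
  is_derive t 1 x dx -> is_derive t 1 y dy ->
  is_derive t 1 (fun s => dotv (x s) (y s)) (dotv dx (y t) + dotv (x t) dy).
Proof.
move=> /is_derive_trmx xt yt.
have /is_derive_mxP/(_ 0 0) := is_derive_mulmx xt yt.
by rewrite mxE.
Qed.

Lemma entry_le_norm (R : realType) m n (M : 'M[R]_(m, n)) i j :
  `|M i j| <= `|M|.
Proof.
rewrite [leRHS]/Num.Def.normr/= mx_normrE.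
exact: (le_bigmax _ (fun ij : 'I_m * 'I_n => `|M ij.1 ij.2|) (i, j)).
Qed.

Lemma cvg_mx_entry (R : realType) (T : Type) (F : set_system T) m n
    (f : T -> 'M[R]_(m, n)) (l : 'M[R]_(m, n)) i j : Filter F ->
  f @ F --> l -> f x i j @[x --> F] --> l i j.
Proof.
move=> FF fl.
apply: (@cvg_comp _ _ _ f (fun M : 'M[R]_(m, n) => M i j) _ _ _ fl).
exact: coord_continuous.
Qed.

Lemma cvg_mulmx_entry (R : realType) (T : Type) (F : set_system T) m n p
    (f : T -> 'M[R]_(m, n)) (g : T -> 'M[R]_(n, p)) (l : 'M[R]_(m, n))
    (k : 'M[R]_(n, p)) i j : Filter F ->
  f @ F --> l -> g @ F --> k -> (f x *m g x) i j @[x --> F] --> (l *m k) i j.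
Proof.
move=> FF fl gk; rewrite mxE; under eq_cvg do rewrite mxE.
apply: cvg_big => [|r _]; first exact: add_continuous.
by apply: cvgM; exact: cvg_mx_entry.
Qed.

(** * Gronwall's argument and the explicit inverse of the solution *)

Lemma dotv_mulmx_le (R : realType) n (L : 'M[R]_n) (y : 'cV[R]_n) K :
  (forall i j, `|L i j| <= K) ->
  `|dotv y (L *m y)| <= K * (n * n)%:R * dotv y y.
Proof.
move=> LK; have yy i j : `|y i 0 * y j 0| <= dotv y y.
  rewrite normrM; have := sqr_coord_le y i; have := sqr_coord_le y j.
  rewrite -(real_normK (num_real (y i 0))) -(real_normK (num_real (y j 0))).
  have := sqr_ge0 (`|y i 0| - `|y j 0|); nra.
rewrite dotvE (le_trans (ler_norm_sum _ _ _))//.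
have -> : K * (n * n)%:R * dotv y y = \sum_(i < n) \sum_(j < n) (K * dotv y y).
  by rewrite !sumr_const card_ord -mulrnA mulrAC mulr_natr.
apply: ler_sum => i _; rewrite mxE mulr_sumr (le_trans (ler_norm_sum _ _ _))//.
apply: ler_sum => j _; rewrite mulrCA normrM.
by apply: ler_pM.
Qed.

(** The function g(s) = exp(- k s) |y(s)|^2 is nonincreasing on ]0, T], because 2 <y, L y> <= k
    |y|^2. It tends to 0 at 0 from the right, so it cannot be positive later. Only a one-sided limit
    is assumed at 0, as for the Riccati solution. *)
Lemma linear_ode_zero (R : realType) n (L : R -> 'M[R]_n) (y : R -> 'cV[R]_n)
    (K T : R) :
  (forall t, 0 < t <= T -> is_derive t 1 y (L t *m y t)) ->
  (forall t, 0 < t <= T -> forall i j, `|L t i j| <= K) ->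
  (forall i, y t i 0 @[t --> 0^'+] --> 0) ->
  forall t, 0 < t <= T -> y t = 0.
Proof.
move=> yL LK y0 t tT; apply/eqP; rewrite -dotv_eq0 eq_le dotv_ge0 andbT.
pose k := 2 * (`|K| * (n * n)%:R).
have k0 : 0 <= k by rewrite !mulr_ge0.
pose g s := expR (- k * s) * dotv (y s) (y s).
have dg s : 0 < s <= T -> is_derive s 1 g (expR (- k * s) *
    (2 * dotv (y s) (L s *m y s) - k * dotv (y s) (y s))).
  move=> sT; have ys := yL s sT.
  have dy := is_derive_dotv ys ys.
  have de : is_derive s 1 (fun s => expR (- k * s)) (expR (- k * s) * - k).
    apply: (@is_derive1_comp _ expR (fun s => - k * s)).
    apply: is_derive_eq (is_deriveZ (- k) (is_derive_id s 1)) _.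
    by rewrite [LHS]mulr1.
  apply: is_derive_eq (is_deriveM de dy) _.
  rewrite /GRing.scale/= (dotvC (L s *m _)); ring.
have gle r s : 0 < r -> r <= s -> s <= T -> g s <= g r.
  move=> r0 rs sT; apply: (@ler0_derive1_le_oc _ g 0 T).
  - move=> x; rewrite in_itv/= => /andP[x0 /ltW xT].
    by have [] := dg x; rewrite ?x0.
  - move=> x; rewrite in_itv/= => /andP[x0 /ltW xT]; rewrite derive1E.
    have xT' : 0 < x <= T by rewrite x0.
    have [_ ->] := dg x xT'.
    rewrite pmulr_rle0 ?expR_gt0// subr_le0 /k -mulrA ler_pM2l//.
    rewrite (le_trans (ler_norm _))// dotv_mulmx_le// => i j.
    exact: le_trans (LK x xT' i j) (ler_norm _).
  - apply: derivable_within_continuous => x; rewrite in_itv/= => xT.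
    by have [] := dg x xT.
  - by rewrite in_itv/= sT andbT (lt_le_trans r0).
  - by rewrite in_itv/= r0 (le_trans rs).
  - exact: rs.
have /andP[t0 tT'] := tT.
suff : g t <= 0 by rewrite pmulr_rle0 ?expR_gt0.
have y00 : dotv (y s) (y s) @[s --> 0^'+] --> 0.
  have : \sum_i y s i 0 * y s i 0 @[s --> 0^'+] --> \sum_(i < n) (0 * 0 : R).
    apply: cvg_big => [|i _]; first exact: add_continuous.
    exact: cvgM.
  under eq_cvg do rewrite -dotvE.
  by rewrite big1// => i _; rewrite mulr0.
(* For small s > 0, g(t) <= g(s) <= |y(s)|^2, and the last term tends to 0. *)
apply: (cvgr_to_ge y00); near=> s.
have s0 : 0 < s by near: s; exact: nbhs_right_gt.
apply: le_trans (gle s t s0 _ tT') _.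
  by near: s; exact: nbhs_right_le.
rewrite /g ler_piMl ?dotv_ge0// -expR0 ler_expR mulNr oppr_le0.
by rewrite mulr_ge0// ltW.
Unshelve. all: by end_near. Qed.

(** The norm is continuous on the compact interval [0, T], so it attains a maximum; this bounds the
    coefficients in the Gronwall argument. *)
Lemma derivable_norm_bound (R : realType) m n (F : R -> 'M[R]_(m, n)) (T : R) :
  0 < T -> F t @[t --> 0^'+] --> F 0 ->
  (forall t, 0 < t -> derivable F t 1) ->
  exists K, forall t, 0 < t <= T -> `|F t| <= K.
Proof.
move=> T0 F0 dF.
have Fc t : 0 < t -> {for t, continuous F}.
  by move=> /dF Ft; exact/differentiable_continuous/derivable1_diffP.
have cF : {within `[0, T], continuous F}.
  apply/continuous_within_itvP; first exact: T0.
  split; [|exact: F0|].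
    by move=> t; rewrite in_itv/= => /andP[/Fc].
  exact/cvg_at_left_filter/Fc.
have cNF : {within `[0, T], continuous (Num.norm \o F)}.
  by apply: within_continuous_comp cF => x _; exact: norm_continuous.
have [c _ cmax] := EVT_max (ltW T0) cNF.
by exists `|F c| => t /andP[/ltW t0 tT]; apply: cmax; rewrite in_itv/= t0.
Qed.

(* [C P - 1], with [P] the claimed inverse of [C], satisfies the linear equation
   [y' = - alpha C A^T Gamma^-1 A y] with zero initial value. *)
Lemma riccati_solution_inv (R : realType) (m n : nat) (A : 'M[R]_(m, n))
    (Gamma : 'M[R]_m) (C0 : 'M[R]_n) (alpha : R) (C : R -> 'M[R]_n) :
  C0 \in unitmx -> riccati_solution A Gamma alpha C0 C ->
  forall t, 0 <= t -> C t *m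
    (invmx C0 + (alpha * t) *: (A^T *m invmx Gamma *m A)) = 1%:M.
Proof.
move=> uC0 [C00 C0r dC] T; rewrite le_eqVlt => /predU1P[<-|T0].
  by rewrite mulr0 scale0r addr0 C00 mulmxV.
set B := A^T *m invmx Gamma *m A; set P := invmx C0 + _.
(* Basis vectors [c] recover the columns, and [linear_ode_zero] applies to vector-valued
   functions. *)
suff CP (c : 'cV[R]_n) : C T *m (P *m c) = c.
  apply/matrixP => i j; have /colP/(_ i) := CP (delta_mx j 0).
  by rewrite mulmxA -colE !mxE andbT.
pose q (s : R) : 'cV[R]_n := invmx C0 *m c + s *: (alpha *: (B *m c)).
have qT : P *m c = q T.
  by rewrite mulmxDl -scalemxAl mulrC -scalerA.
have dq (s : R) : is_derive s 1 q (alpha *: (B *m c)).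
  have ds : is_derive s (1 : R) id (1 : R) by exact: is_derive_id.
  apply/is_derive_mxP => i j.
  rewrite (_ : (fun s => _) = cst ((invmx C0 *m c) i j) +
     (alpha *: (B *m c)) i j \*: id); last first.
    by apply/funext => r; rewrite !mxE [r * _]mulrC.
  apply: is_derive_eq (is_deriveD (is_derive_cst _ s 1)
    (is_deriveZ ((alpha *: (B *m c)) i j) ds)) _.
  by rewrite add0r [LHS]mulr1.
(* With B c the slope of q up to alpha, y' = - alpha C B C q + alpha C B c = - alpha C B (C q -
   c). *)
pose L s := - alpha *: (C s *m B).
pose y s := C s *m q s - c.
have dy s : 0 < s <= T -> is_derive s 1 y (L s *m y s).
  move=> /andP[s0 _].
  have dCq := is_derive_mulmx (dC s s0) (dq s).
  apply: is_derive_eq (is_deriveB dCq (is_derive_cst c s 1)) _.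
  rewrite /L /y subr0 mulmxBr -!scalemxAl -scalemxAr !scaleNr opprK.
  by rewrite /B !mulmxA.
have [K CK] : exists K, forall t, 0 < t <= T -> `|C t| <= K.
  by apply: derivable_norm_bound => //; [rewrite C00|move=> t /dC[]].
rewrite qT; apply/eqP; rewrite -subr_eq0 -/(y T); apply/eqP.
apply: (@linear_ode_zero _ _ L y (`|alpha| * (K * `|B| *+ n)) T) => //.
- move=> t tT i j; rewrite mxE normrM normrN ler_wpM2l// mxE.
  rewrite (le_trans (ler_norm_sum _ _ _))//.
  rewrite -[n in _ *+ n]card_ord -sumr_const ler_sum// => k _.
  rewrite normrM ler_pM// ?entry_le_norm//.
  exact: le_trans (entry_le_norm _ _ _) (CK t tT).
- move=> i; have q0 : q t @[t --> 0^'+] --> q 0.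
    apply: cvg_at_right_filter; apply/differentiable_continuous.
    by apply/derivable1_diffP; have [] := dq 0.
  have Cq0 : (C t *m q t) i 0 @[t --> 0^'+] --> (C0 *m q 0) i 0.
    exact: cvg_mulmx_entry.
  have -> : (fun t => y t i 0) = fun t => (C t *m q t) i 0 - c i 0.
    by apply/funext => t; rewrite !mxE.
  have := cvgB Cq0 (cvg_cst (c i 0)).
  rewrite {2}/q scale0r addr0 mulKVmx// subrr; exact.
- by rewrite T0 lexx.
Qed.

(** * Differentiating an eigensystem *)

(** As [U] is open, the eigen-relations hold near [t] and can be differentiated. By symmetry of
    [C t], the term <v_i, C v_j'> is lam_i <v_i, v_j'>, which the first identity turns into - lam_i
    <v_i', v_j>. *)
Lemma eigen_system_derive (R : realType) n (U : set R) (C : R -> 'M[R]_n) dC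
    (lam : 'I_n -> R -> R) (v : 'I_n -> R -> 'cV[R]_n) (t : R) :
  open U -> (forall s, U s -> eigen_system (C s) (lam^~ s) (v^~ s)) -> U t ->
  is_derive t 1 C dC ->
  (forall i, derivable (lam i) t 1 /\ derivable (v i) t 1) ->
  forall i j,
    dotv ('D_1 (v i) t) (v j t) + dotv (v i t) ('D_1 (v j) t) = 0 /\
    (lam j t - lam i t) * dotv ('D_1 (v i) t) (v j t)
      + dotv (v i t) (dC *m v j t) = (i == j)%:R * 'D_1 (lam j) t.
Proof.
move=> oU eU Ut tC tlv i j.
have [li vi] := tlv i; have [lj vj] := tlv j.
have {}vi := derivableP vi; have {}vj := derivableP vj.
have nU : \forall s \near t, U s by exact: open_nbhs_nbhs.
have orth : dotv ('D_1 (v i) t) (v j t) + dotv (v i t) ('D_1 (v j) t) = 0.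
  have vv := is_derive_dotv vi vj.
  rewrite -(@derive_val _ _ _ _ _ _ _ vv) -(derive_cst ((i == j)%:R : R) t 1).
  apply: near_eq_derive; apply: filterS nU => s Us.
  by have [_ ->] := eU s Us.
split=> //; have [Cv _] := eU t Ut.
have vCv := is_derive_dotv vi (is_derive_mulmx tC vj).
have := @derive_val _ _ _ _ _ _ _ vCv.
rewrite (@near_eq_derive _ _ _ _ ((i == j)%:R \*: lam j)); last first.
  apply: filterS nU => s Us; have [Cvs vvs] := eU s Us.
  by rewrite Cvs dotvZr vvs mulrC.
rewrite deriveZ// => dE; apply/esym; rewrite -[LHS]/(_ *: _) dE.
rewrite dotvDr Cv dotvZr (eigen_sym (eU t Ut)) Cv dotvZl.
move/eqP : orth; rewrite addr_eq0 => /eqP ->; ring.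
Qed.

(** * Eigenvalue bounds and long-time limits *)

(** This turns the fractions in (ii) into additive bounds on the eigenvalues of the inverse. *)
Lemma divr_mulD1 (R : realFieldType) (a c : R) :
  0 < a -> 0 <= c -> a / (c * a + 1) = (a^-1 + c)^-1.
Proof.
move=> a0 c0; have ca : c * a + 1 != 0.
  by rewrite gt_eqF// ltr_wpDl// mulr_ge0// ltW.
by field; rewrite gt_eqF// addrC.
Qed.

Lemma divr_mulD1_le (R : realFieldType) (a b c : R) :
  0 < a -> 0 < b -> 0 <= c ->
  (a / (c * a + 1) <= b) = (b^-1 <= a^-1 + c).
Proof.
by move=> a0 b0 c0; rewrite divr_mulD1// invf_ple// posrE ltr_wpDr ?invr_gt0.
Qed.

Lemma divr_mulD1_ge (R : realFieldType) (a b c : R) :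
  0 < a -> 0 < b -> 0 <= c ->
  (b <= a / (c * a + 1)) = (a^-1 + c <= b^-1).
Proof.
by move=> a0 b0 c0; rewrite divr_mulD1// invf_pge// posrE ltr_wpDr ?invr_gt0.
Qed.

Section RiccatiSpectrum.
Variables (R : realType) (m n : nat) (A : 'M[R]_(m, n)) (Gamma : 'M[R]_m).
Variables (C0 : 'M[R]_n) (alpha : R) (C : R -> 'M[R]_n).
Hypotheses (pG : sym_posdef Gamma) (pC0 : sym_posdef C0) (alpha0 : 0 < alpha).
Hypothesis solC : riccati_solution A Gamma alpha C0 C.
Variables (lam : 'I_n -> R -> R) (v : 'I_n -> R -> 'cV[R]_n).
Hypothesis eC : forall t, 0 <= t -> eigen_system (C t) (lam^~ t) (v^~ t).
Hypothesis lam_sorted : forall t, 0 <= t ->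
  forall i j : 'I_n, (i <= j)%N -> lam j t <= lam i t.

(* The inverse of [C t]. *)
Let P t := invmx C0 + (alpha * t) *: (A^T *m invmx Gamma *m A).

Let P_form t x :
  dotv x (P t *m x) = dotv x (P 0 *m x) + alpha * t * gnorm2 Gamma (A *m x).
Proof.
rewrite /P mulr0 scale0r addr0 mulmxDl dotvDr -scalemxAl dotvZr.
by rewrite /gnorm2 /gdot dotv_mull !mulmxA.
Qed.

Let P_eigen t : 0 <= t -> eigen_system (P t) (fun i => (lam i t)^-1) (v^~ t).
Proof.
move=> t0; have CP := riccati_solution_inv (posdef_unit pC0) solC t0.
have [uC _] := mulmx1_unit CP.
have -> : P t = invmx (C t) by rewrite -[RHS]mulmx1 -CP mulKmx.
exact: eigen_system_inv (eC t0) uC.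
Qed.

Let unit_v t i : 0 <= t -> dotv (v i t) (v i t) = 1.
Proof. by move=> /eC[_ ->]; rewrite eqxx. Qed.

Let inv_lamE t i : 0 <= t -> (lam i t)^-1 = dotv (v i t) (P t *m v i t).
Proof.
by move=> t0; have [-> _] := P_eigen t0; rewrite dotvZr unit_v ?mulr1.
Qed.

Let P0_gt0 t i : 0 <= t -> 0 < dotv (v i t) (P 0 *m v i t).
Proof.
move=> t0; rewrite /P mulr0 scale0r addr0; have [_ pC] := posdef_inv pC0.
exact/pC/(eigen_neq0 (eC t0)).
Qed.

(** The inverse of [lam i t] is the form of [P t] at a unit vector, hence at least that of [P 0],
    which is positive. *)
Let lam_gt0 t i : 0 <= t -> 0 < lam i t.
Proof.
move=> t0; rewrite -invr_gt0 inv_lamE// P_form ltr_wpDr ?P0_gt0//.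
by rewrite !mulr_ge0 ?gnorm2_ge0// ltW.
Qed.

Let inv_lam_sorted t : 0 <= t ->
  forall i j : 'I_n, (i <= j)%N -> (lam i t)^-1 <= (lam j t)^-1.
Proof. by move=> t0 i j ij; rewrite lef_pV2 ?posrE ?lam_gt0 ?lam_sorted. Qed.

(** Weyl's inequality compares [P 0] with [P t]: their forms differ by alpha t |A x|_Gamma^2, which
    the operator norm bounds. *)
Lemma riccati_eigenvalue_ge t i : 0 <= t ->
  lam i 0 / (alpha * opnorm (invmx (sqrtmx Gamma) *m A) ^+ 2 * t * lam i 0 + 1)
    <= lam i t.
Proof.
move=> t0; have c0 : 0 <= alpha * opnorm (invmx (sqrtmx Gamma) *m A) ^+ 2 * t.
  by rewrite mulr_ge0// mulr_ge0 ?sqr_ge0 ?ltW.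
rewrite divr_mulD1_le ?lam_gt0//.
apply: (weyl_le (P_eigen (lexx 0)) (P_eigen t0) (inv_lam_sorted (lexx 0))
  (inv_lam_sorted t0)) => x.
rewrite P_form lerD2l (mulrAC alpha (_ ^+ 2)) -[leRHS]mulrA.
rewrite ler_wpM2l ?mulr_ge0 ?(ltW alpha0)//.
by rewrite gnorm2_sqrtmx// mulmxA dotv_opnorm.
Qed.

(** The inverse of [lam i t] is now the least eigenvalue of [P t], so it is at most the Rayleigh
    quotient at [v i 0]. *)
Lemma riccati_top_eigenvalue_ge t (i : 'I_n) :
  0 <= t -> (forall j : 'I_n, (i <= j)%N) ->
  lam i 0 / (alpha * gnorm2 Gamma (A *m v i 0) * t * lam i 0 + 1) <= lam i t.
Proof.
move=> t0 imin.
rewrite divr_mulD1_le ?lam_gt0 ?mulr_ge0 ?gnorm2_ge0 ?(ltW alpha0)//.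
rewrite (@inv_lamE 0 i (lexx 0)) mulrAC -P_form -[leLHS]mulr1.
rewrite -(@unit_v 0 i (lexx 0)).
by apply: (eigen_form_ge (P_eigen t0)) => j _; exact: inv_lam_sorted.
Qed.

Lemma riccati_bottom_eigenvalue_le t (i : 'I_n) : 0 <= t ->
  (forall j : 'I_n, (j <= i)%N) ->
  lam i t <= lam i 0 / (alpha * gnorm2 Gamma (A *m v i 0) * t * lam i 0 + 1).
Proof.
move=> t0 imax.
rewrite divr_mulD1_ge ?lam_gt0 ?mulr_ge0 ?gnorm2_ge0 ?(ltW alpha0)//.
rewrite (@inv_lamE 0 i (lexx 0)) mulrAC -P_form -[leRHS]mulr1.
rewrite -(@unit_v 0 i (lexx 0)).
by apply: (eigen_form_le (P_eigen t0)) => j _; exact: inv_lam_sorted.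
Qed.

(** The form of [P] grows with time, so Weyl's inequality applies with [c = 0]. *)
Let lam_nincr s t i : 0 <= s -> s <= t -> lam i t <= lam i s.
Proof.
move=> s0 st; have t0 := le_trans s0 st.
rewrite -lef_pV2 ?posrE ?lam_gt0// -[leRHS]addr0.
apply: (weyl_le (P_eigen t0) (P_eigen s0) (inv_lam_sorted t0)
  (inv_lam_sorted s0)) => x.
rewrite mul0r addr0 P_form (P_form t) lerD2l ler_wpM2r ?gnorm2_ge0//.
by rewrite ler_wpM2l// ltW.
Qed.

Let gnorm2_eigen_le t i : 0 < t ->
  gnorm2 Gamma (A *m v i t) <= (alpha * t * lam i t)^-1.
Proof.
move=> t0; have t0' := ltW t0.
rewrite invfM -ler_pdivrMl ?invr_gt0 ?mulr_gt0// invrK inv_lamE// (P_form t).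
by rewrite lerDr ltW// P0_gt0.
Qed.

Lemma riccati_eigen_limit i :
  (lam i t @[t --> +oo] --> 0) \/
  (A *m v i t @[t --> +oo] --> (0 : 'cV[R]_m)).
Proof.
(* Either [lam i] takes arbitrarily small values, and then monotonicity gives the limit 0, or it
   stays above some [e > 0]. *)
have [small|/existsNP[e /not_implyP[e0 big]]] :=
    pselect (forall e, 0 < e -> exists2 t, 0 <= t & lam i t <= e).
  left; apply/cvgr0Pnorm_le => e e0; have [s s0 se] := small e e0.
  near=> t; have st : s <= t by near: t; exact: nbhs_pinfty_ge (num_real _).
  rewrite ger0_norm ?(le_trans (lam_nincr _ s0 st))//.
  exact/ltW/lam_gt0/(le_trans s0).
have {}big t : 0 <= t -> e <= lam i t.
  move=> t0; rewrite leNgt; apply/negP => /ltW te.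
  by apply: big; exists t.
right; pose S := sqrtmx Gamma.
have uS : S \in unitmx by have [/posdef_unit] := sqrtmx_posdef pG.
(* The limit is in the sup norm: A v = S z, so coordinates of [z] of size at most [r] give a norm of
   at most |S| m r <= d. The added 1 keeps the denominator positive. *)
apply/cvgr0Pnorm_le => d d0; pose r := d / (`|S| * m%:R + 1).
have Sm : 0 < `|S| * m%:R + 1 by rewrite ltr_wpDl// mulr_ge0.
have r0 : 0 < r by rewrite divr_gt0.
near=> t; have t0 : 0 < t by near: t; exact: nbhs_pinfty_gt (num_real _).
pose z := invmx S *m (A *m v i t).
(* The squared length of [z] is the weighted norm of A v, at most 1 / (alpha t e), which falls below
   r^2 for large [t]. *)
have zz : dotv z z <= r ^+ 2.
  rewrite -gnorm2_sqrtmx// (le_trans (gnorm2_eigen_le _ t0))//.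
  rewrite (@le_trans _ _ (alpha * t * e)^-1)//.
    by rewrite lef_pV2 ?posrE ?mulr_gt0 ?lam_gt0 ?ler_wpM2l ?mulr_ge0 ?big ?ltW.
  rewrite mulrAC invfM ler_pdivrMr; last exact: t0.
  rewrite -ler_pdivrMl; last exact: exprn_gt0.
  by near: t; exact: nbhs_pinfty_ge (num_real _).
rewrite -(mulKVmx uS (A *m v i t)) -/z.
rewrite [leLHS]/Num.Def.normr/= mx_normrE (bigmax_le _ (ltW d0))//= => -[k l] _.
rewrite mxE (le_trans (ler_norm_sum _ _ _))//.
apply: (@le_trans _ _ (\sum_(j < m) `|S| * r)).
  apply: ler_sum => j _; rewrite normrM ler_pM ?entry_le_norm// ord1.
  rewrite -ler_sqr ?nnegrE ?(ltW r0)// real_normK ?num_real//.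
  exact: le_trans (sqr_coord_le _ _) zz.
rewrite sumr_const card_ord -mulr_natr mulrAC /r mulrCA ger_pMr//.
by rewrite ler_pdivrMr// mul1r lerDl.
Unshelve. all: by end_near. Qed.

End RiccatiSpectrum.

Theorem theorem5p1 (R : realType) (m n : nat)
  (A : 'M[R]_(m, n.+1)) (Gamma : 'M[R]_m) (C0 : 'M[R]_n.+1) (alpha : R)
  (C : R -> 'M[R]_n.+1) :
  sym_posdef Gamma -> sym_posdef C0 -> 0 < alpha ->
  riccati_solution A Gamma alpha C0 C ->
  (* (i) *)
  (forall (U : set R) (lam : 'I_n.+1 -> R -> R) (v : 'I_n.+1 -> R -> 'cV[R]_n.+1),
    open U -> is_interval U -> U `<=` [set t | 0 <= t] ->
    (forall t, U t -> eigen_system (C t) (lam^~ t) (v^~ t)) ->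
    (forall i t, U t -> derivable (lam i) t 1 /\ derivable (v i) t 1) ->
    (forall i j, (forall t, U t -> lam i t != lam j t) \/
                 (forall t, U t -> lam i t = lam j t)) ->
    (forall i j, i != j -> (forall t, U t -> lam i t = lam j t) ->
       forall t, U t -> dotv ('D_1 (v i) t) (v j t) = 0) ->
    forall t, U t ->
      [/\ forall i,
            'D_1 (lam i) t = - alpha * lam i t ^+ 2 * gnorm2 Gamma (A *m v i t),
          forall i,
            'D_1 (v i) t =
              \sum_(j < n.+1 | lam j t != lam i t)
                (alpha * lam i t * lam j t / (lam j t - lam i t)
                   * gdot Gamma (A *m v i t) (A *m v j t)) *: v j t
        & forall i j, i != j -> lam i t = lam j t ->
            0 = lam i t ^+ 2 * gdot Gamma (A *m v i t) (A *m v j t)])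
  /\
  (forall (lam : 'I_n.+1 -> R -> R) (v : 'I_n.+1 -> R -> 'cV[R]_n.+1),
    (forall t, 0 <= t -> eigen_system (C t) (lam^~ t) (v^~ t)) ->
    (forall t, 0 <= t ->
       forall i j : 'I_n.+1, (i <= j)%N -> lam j t <= lam i t) ->
    (* (ii) *)
    (forall t, 0 <= t ->
      [/\ forall i,
            lam i 0 / (alpha * opnorm (invmx (sqrtmx Gamma) *m A) ^+ 2
                         * t * lam i 0 + 1) <= lam i t,
          lam ord0 0 / (alpha * gnorm2 Gamma (A *m v ord0 0)
                          * t * lam ord0 0 + 1) <= lam ord0 t
        & lam ord_max t <=
            lam ord_max 0 / (alpha * gnorm2 Gamma (A *m v ord_max 0)
                               * t * lam ord_max 0 + 1)])
    /\
    (* (iii) *)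
    (forall i,
      (lam i t @[t --> +oo] --> 0) \/
      (A *m v i t @[t --> +oo] --> (0 : 'cV[R]_m)))).
Proof.
move=> pG pC0 alpha0 solC; split; last first.
  move=> lam v eC lamS; split=> [t t0|i]; last first.
    exact: (riccati_eigen_limit pG pC0 alpha0 solC eC lamS).
  split=> [i||].
  - exact: (riccati_eigenvalue_ge pG pC0 alpha0 solC eC lamS).
  - exact: (riccati_top_eigenvalue_ge pG pC0 alpha0 solC eC lamS).
  - apply: (riccati_bottom_eigenvalue_le pG pC0 alpha0 solC eC lamS) => // j.
    exact: leq_ord.
move=> U lam v oU _ U0 eU dU sepU gaugeU t Ut.
(* An open set of nonnegative times cannot contain 0, so the differential equation is available at
   [t]. *)
have t0 : 0 < t.
  rewrite lt0r (U0 _ Ut : 0 <= t) andbT; apply/eqP => tz.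
  have [e /= e0 eUt] : nbhs_ball t U by apply/nbhs_ballP/open_nbhs_nbhs.
  have /U0 /= : U (t - e / 2).
    apply: eUt; rewrite /ball/= opprB addrC subrK gtr0_norm ?divr_gt0//.
    by rewrite ltr_pdivrMr// ltr_pMr// ltr1n.
  by rewrite tz sub0r oppr_ge0 leNgt divr_gt0.
have [_ _ /(_ t t0) dC] := solC.
have eqs := eigen_system_derive oU eU Ut dC (fun i => dU i t Ut).
have et := eU t Ut; have [Cv vv] := et.
have vdCv i j : dotv (v i t)
    (- alpha *: (C t *m A^T *m invmx Gamma *m A *m C t) *m v j t) =
    - (alpha * lam i t * lam j t * gdot Gamma (A *m v i t) (A *m v j t)).
  rewrite -scalemxAl dotvZr -!mulmxA (eigen_sym et) !Cv dotvZl.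
  rewrite -!scalemxAr dotvZr.
  rewrite /gdot dotv_mull; ring.
have dv_ortho i : dotv ('D_1 (v i) t) (v i t) = 0.
  have [+ _] := eqs i i; rewrite [dotv (v i t) _]dotvC => ?; lra.
split=> [i|i|i j ij lij].
- have [_] := eqs i i; rewrite vdCv eqxx mul1r subrr mul0r add0r => <-.
  by rewrite /gnorm2; ring.
(* Expand v_i' in the basis v_j. The coefficient at j = i vanishes by normalization, and those with
   lam_j = lam_i vanish by the gauge condition; [sepU] extends equality at [t] to all of [U]. The
   others follow on division by lam_j - lam_i. *)
- rewrite [LHS](eigen_expansion et) [RHS]big_mkcond; apply: eq_bigr => j _.
  rewrite dotvC; have [->|ij] := eqVneq j i.
    by rewrite dv_ortho scale0r eqxx.
  case: ifPn => [lij|/negPn/eqP lij]; last first.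
    have [/(_ t Ut)|same] := sepU i j; first by rewrite lij eqxx.
    by rewrite gaugeU 1?eq_sym// scale0r.
  have [_] := eqs i j; rewrite vdCv eq_sym (negPf ij) mul0r => /eqP.
  rewrite subr_eq0 => /eqP E; congr (_ *: _).
  have lij' : lam j t - lam i t != 0 by rewrite subr_eq0.
  by apply: (mulfI lij'); rewrite E; field.
(* With equal eigenvalues the off-diagonal identity leaves only the term from the derivative of [C],
   and alpha > 0 cancels. *)
- have [_] := eqs i j; rewrite vdCv lij subrr mul0r add0r (negPf ij) mul0r.
  move/eqP; rewrite oppr_eq0 -!mulrA mulf_eq0 gt_eqF//= => /eqP E.
  by rewrite E.
Qed.
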